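(* Let $G$ be a Cohen-Macaulay very well-covered graph. If $G$ has exactly two leaves, then $G$ is bipartite.
   Context: Graphs are finite and simple. A graph $G$ without isolated vertices is very well-covered if $|V(G)|$ is even and every maximal (with respect to inclusion) independent set of $G$ has cardinality $|V(G)|/2$. A leaf is a vertex of degree $1$. Let $K$ be a field and $R$ the polynomial ring over $K$ whose variables are the vertices of $G$; the edge ideal is $I(G)=(uv : uv\in E(G))\subset R$, and $G$ is called Cohen-Macaulay if $R/I(G)$ is a Cohen-Macaulay ring. *)

(* Defs.v *)
From HB Require Import structures.
From mathcomp Require Import all_boot all_order all_algebra.
From mathcomp Require Import boolp.
From mathcomp Require Import mpoly.

Set Implicit Arguments.
Unset Strict Implicit.
Unset Printing Implicit Defensive.

Import GRing.Theory.
Local Open Scope ring_scope.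

Section CommutativeAlgebra.
Variable A : comNzRingType.
Implicit Types (P Q M J : {pred A}) (s : seq A).

Definition ideal_gen s : {pred A} :=
  fun x => `[< exists c : 'I_(size s) -> A, x = \sum_(i < size s) c i * s`_i >].

(* [idealr_closed] from ring_quotient requires 1 \notin J; the unit ideal, left
   out here, is finitely generated anyway. *)
Definition noetherian : Prop :=
  forall J, idealr_closed J -> exists s, J =i ideal_gen s.

Definition prime_ideal P : Prop := idealr_closed P /\ prime_idealr_closed P.

Definition maximal_ideal M : Prop :=
  idealr_closed M /\
  forall J, idealr_closed J -> {subset M <= J} -> {subset J <= M}.

Definition strict_subset P Q : Prop :=
  {subset P <= Q} /\ ~ {subset Q <= P}.

(* p 0 < p 1 < ... < p n = P; the values p i with n < i are irrelevant. *)
Definition prime_chain (p : nat -> {pred A}) (n : nat) P : Prop :=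
  [/\ forall i, (i <= n)%N -> prime_ideal (p i),
      forall i, (i < n)%N -> strict_subset (p i) (p i.+1)
    & p n =i P].

Definition has_height P (n : nat) : Prop :=
  (exists p, prime_chain p n P) /\
  (forall p m, prime_chain p m P -> (m <= n)%N).

Definition regular_seq s : Prop :=
  1 \notin ideal_gen s /\
  forall i y, (i < size s)%N ->
    s`_i * y \in ideal_gen (take i s) -> y \in ideal_gen (take i s).

Definition has_depth P (n : nat) : Prop :=
  (exists s, [/\ regular_seq s, {subset s <= P} & size s = n]) /\
  (forall s, regular_seq s -> {subset s <= P} -> (size s <= n)%N).

(* Eisenbud, Commutative Algebra, Section 18.2: depth M = codim M for every
   maximal ideal M of a Noetherian ring. *)
Definition cohen_macaulay_ring : Prop :=
  noetherian /\
  forall M, maximal_ideal M -> exists n, has_height M n /\ has_depth M n.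

Lemma ideal_gen_closed s :
  1 \notin ideal_gen s -> idealr_closed (ideal_gen s).
Proof.
move=> s1; split=> //.
  by apply/asboolP; exists (fun=> 0); rewrite big1 // => i _; rewrite mul0r.
move=> a x y /asboolP[c ->] /asboolP[d ->]; apply/asboolP.
exists (fun i => a * c i + d i).
rewrite mulr_sumr -big_split /=; apply: eq_bigr => i _.
by rewrite mulrDl mulrA.
Qed.

End CommutativeAlgebra.

Section EdgeRing.
Variables (K : fieldType) (T : finType) (e : rel T).

(* The variable attached to the vertex u. *)
Definition vvar (u : T) : {mpoly K[#|T|]} := 'X_(enum_rank u).

Definition edge_monomials : seq {mpoly K[#|T|]} :=
  [seq vvar uv.1 * vvar uv.2 | uv <- enum [set uv : T * T | e uv.1 uv.2]].

Definition edge_ideal : {pred {mpoly K[#|T|]}} := ideal_gen edge_monomials.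

Lemma edge_ideal_proper : 1 \notin edge_ideal.
Proof.
apply/negP => /asboolP[c /(congr1 (meval (fun=> 0)))].
rewrite meval1 raddf_sum /= big1 => [/eqP|i _]; first by rewrite oner_eq0.
rewrite mevalM.
have /mapP[uv _ ->] : edge_monomials`_i \in edge_monomials by exact: mem_nth.
by rewrite mevalM !mevalXU !mulr0.
Qed.

HB.instance Definition _ := isIdealr.Build {mpoly K[#|T|]} edge_ideal
  (ideal_gen_closed edge_ideal_proper).

Definition edge_ring : comNzRingType := {ideal_quot edge_ideal}.

End EdgeRing.

Section Graphs.
Variables (T : finType) (e : rel T).

Definition degree (u : T) : nat := #|[set v | e u v]|.

Definition leaf (u : T) : bool := degree u == 1%N.

Definition independent (S : {set T}) : bool :=
  [forall u in S, forall v in S, ~~ e u v].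

Definition very_well_covered : Prop :=
  [/\ forall u, degree u != 0%N,
      ~~ odd #|T|
    & forall S : {set T}, maxset independent S -> #|S| = #|T|./2].

Definition bipartite : Prop :=
  exists B : {set T}, forall u v, e u v -> (u \in B) != (v \in B).

Definition cohen_macaulay_graph (K : fieldType) : Prop :=
  cohen_macaulay_ring (edge_ring K e).

End Graphs.

(* Main.v *)
From mathcomp Require Import boolp mpoly.
Require Import Defs.
From HB Require Import structures.
From mathcomp Require Import all_boot all_algebra.
From mathcomp Require Import ring zify.

(** A very well-covered graph has a perfect matching [m]: by Berge's inequality
    ([well_covered_expansion]) a maximal independent set satisfies Hall's
    condition ([hall]). Every maximal independent set contains exactly one vertex
    of each pair [v, m v], so an edge from [u] to [m w] says that [u] forces [w].
    This relation [implies] is a preorder, reversed by [m], in which no vertex is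
    related to its partner, and the leaves are the vertices that imply only
    themselves.

    The Cohen-Macaulay property enters through one consequence: every vertex
    implies a leaf ([implies_leaf]). Granting this, let [p] and [q] be the two
    leaves. A vertex [v] and its partner cannot both imply [p], as [v] implying
    [p] means that [m p] implies [m v], and [m p] does not imply [p]; the same
    holds for [q]. So each of [v], [m v] implies exactly one of the leaves, and
    they imply different ones. An edge between [u] and [w] is an implication from
    [u] to [m w], hence [u] and [w] imply different leaves, and the vertices that
    imply [p] form one side of a bipartition.

    If some vertex implied no leaf, then the preorder would have, above it, a
    terminal class [C] with at least two elements. The vertices of [C] and their
    partners [C'] span a complete bipartite graph, and there is an independent set
    [S] outside whose neighbours these are all the remaining vertices. Near the
    point with coordinates 1 on [S] and 0 elsewhere, the variety of the edge ideal
    is then, up to a torus, the union of the two coordinate spaces of [C] and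
    [C'], which meet in one point. As in Hartshorne's connectedness theorem, such
    a union has depth 1: for [u] in [C] and [u'] in [C'], the element
    [X u + X u'] is regular, and modulo it [X u] is a nonzero element killed by
    the ideal of the point ([link_socle], [link_socle_neq0]). Together with the
    regular elements [X s - 1], for [s] in [S], this gives a regular sequence of
    length [#|S| + 1] modulo which there is a socle. A longer regular sequence in
    the maximal ideal of the point cannot exist, by the exchange property of
    regular sequences in Noetherian rings ([regular_socle_free]). But the height
    of this ideal is at least [#|S| + #|C|] ([point_chain]), contradicting the
    Cohen-Macaulay property ([cohen_macaulay_link]). *)

Set Implicit Arguments.
Unset Strict Implicit.
Unset Printing Implicit Defensive.

Import GRing.Theory.

(** * Ideals and regular sequences *)

Section Ideals.
Local Open Scope ring_scope.
Variable A : comNzRingType.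
Implicit Types (J P Q M : A -> Prop) (s : seq A) (L : seq (A -> Prop)).

Definition ideal J := J 0 /\ forall a x y, J x -> J y -> J (a * x + y).

Definition prime_set P :=
  [/\ ideal P, ~ P 1 & forall x y, P (x * y) -> P x \/ P y].

Definition sub_ideal J Q := forall x, J x -> Q x.

Definition colon J z : A -> Prop := fun x => J (x * z).

Definition adjoin J c : A -> Prop :=
  fun x => exists2 y, J y & exists w, x = y + c * w.

Definition extend J s := foldl adjoin J s.

Definition nonzerodiv J c := forall y, J (c * y) -> J y.

Fixpoint regular J s :=
  if s is c :: s' then nonzerodiv J c /\ regular (adjoin J c) s' else True.

(** For an ideal [M], this is the vanishing of [Hom (A / M, A / J)]. *)
Definition socle_free M J :=
  forall z, (forall m, M m -> J (m * z)) -> J z.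

Lemma idealM J a x : ideal J -> J x -> J (a * x).
Proof. by case=> J0 Jl Jx; rewrite -[_ * _]addr0; apply: Jl. Qed.

Lemma idealD J x y : ideal J -> J x -> J y -> J (x + y).
Proof. by case=> J0 Jl Jx Jy; rewrite -[x]mul1r; apply: Jl. Qed.

Lemma idealN J x : ideal J -> J x -> J (- x).
Proof. by move=> idJ Jx; rewrite -mulN1r; apply: idealM. Qed.

Lemma idealB J x y : ideal J -> J x -> J y -> J (x - y).
Proof. by move=> idJ Jx Jy; apply: idealD => //; apply: idealN. Qed.

Lemma ideal_sum J (I : Type) (r : seq I) (F : I -> A) :
  ideal J -> (forall i, J (F i)) -> J (\sum_(i <- r) F i).
Proof.
move=> idJ JF; apply: big_ind => // [|x y]; first by case: idJ.
exact: idealD.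
Qed.

Lemma ideal_zero : ideal (fun x => x = 0).
Proof. by split=> // a x y -> ->; rewrite mulr0 addr0. Qed.

Lemma ideal_colon J z : ideal J -> ideal (colon J z).
Proof.
move=> [J0 Jl]; split=> [|a x y Jx Jy]; rewrite /colon ?mul0r //.
by rewrite mulrDl -mulrA; apply: Jl.
Qed.

Lemma ideal_adjoin J c : ideal J -> ideal (adjoin J c).
Proof.
move=> [J0 Jl]; split; first by exists 0 => //; exists 0; rewrite mulr0 addr0.
move=> a _ _ [y Jy [w ->]] [y' Jy' [w' ->]].
exists (a * y + y'); first exact: Jl.
by exists (a * w + w'); ring.
Qed.

Lemma sub_adjoin J c : sub_ideal J (adjoin J c).
Proof. by move=> x Jx; exists x => //; exists 0; rewrite mulr0 addr0. Qed.

Lemma mem_adjoin J c : ideal J -> adjoin J c c.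
Proof. by case=> J0 _; exists 0 => //; exists 1; rewrite add0r mulr1. Qed.

Lemma adjoin_min J Q c :
  ideal Q -> sub_ideal J Q -> Q c -> sub_ideal (adjoin J c) Q.
Proof.
move=> idQ JQ Qc _ [y /JQ Qy [w ->]].
by apply: idealD => //; rewrite mulrC; apply: idealM.
Qed.

Lemma adjoinC J c d : adjoin (adjoin J c) d = adjoin (adjoin J d) c.
Proof.
have inC a b x : adjoin (adjoin J a) b x -> adjoin (adjoin J b) a x.
  move=> [_ [y Jy [v ->]] [w ->]]; exists (y + b * w).
    by exists y => //; exists w.
  by exists v; ring.
by apply/funext => x; apply/propext; split; apply: inC.
Qed.

Lemma extend_rcons J s c : extend J (rcons s c) = adjoin (extend J s) c.
Proof. by rewrite /extend foldl_rcons. Qed.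

Lemma extend_adjoin J s c : extend (adjoin J c) s = adjoin (extend J s) c.
Proof.
by elim: s J => [|d s IHs] J //=; rewrite adjoinC -IHs.
Qed.

Lemma ideal_extend J s : ideal J -> ideal (extend J s).
Proof. by elim: s J => [|c s IHs] J //= idJ; apply/IHs/ideal_adjoin. Qed.

Lemma sub_extend J s : sub_ideal J (extend J s).
Proof. by elim: s J => [|c s IHs] J x //= /(sub_adjoin c) /IHs. Qed.

Lemma mem_extend J s c : ideal J -> c \in s -> extend J s c.
Proof.
elim: s J => [|d s IHs] J //= idJ; rewrite in_cons => /predU1P[->|].
  exact/sub_extend/mem_adjoin.
exact/IHs/ideal_adjoin.
Qed.

Lemma extend_min J Q s :
  ideal Q -> sub_ideal J Q -> (forall c, c \in s -> Q c) ->
  sub_ideal (extend J s) Q.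
Proof.
move=> idQ; elim: s J => [|c s IHs] J //= JQ sQ.
apply: IHs => [|d sd]; last by apply: sQ; rewrite in_cons sd orbT.
by apply: adjoin_min => //; apply/sQ/mem_head.
Qed.

Lemma regular_rcons J s c :
  regular J (rcons s c) <-> regular J s /\ nonzerodiv (extend J s) c.
Proof.
elim: s J => [|d s IHs] J /=; first by split=> [[]|[]].
by split=> [[nd /IHs[]]|[[nd rs] nc]] //; split=> //; apply/IHs.
Qed.

Lemma regularP J s :
  regular J s <->
  forall i, (i < size s)%N -> nonzerodiv (extend J (take i s)) s`_i.
Proof.
elim: s J => [|c s IHs] J /=; first by split.
split=> [[nc /IHs rs] [|i] // /rs //|rs].
by split; [apply: (rs 0%N) | apply/IHs => i; apply: (rs i.+1)].
Qed.

(** This is the independence of the first nonvanishing Ext from the regular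
    element that computes it: sending [z] to [w], where [c * z = d * w],
    identifies the socle of [A / (J, d)] with that of [A / (J, c)]. *)
Lemma socle_free_swap M J c d :
  ideal J -> M c -> nonzerodiv J c -> nonzerodiv J d ->
  socle_free M (adjoin J c) -> socle_free M (adjoin J d).
Proof.
move=> idJ Mc nc nd scf z Mz.
have [y Jy [w cz]] := Mz c Mc.
have [|y2 Jy2 [t def_w]] := scf w.
  move=> m Mm; have [y' Jy' [u mz]] := Mz m Mm.
  exists (m * w - c * u); last by exists u; ring.
  apply: nd; rewrite (_ : _ * _ = c * y' - m * y).
    by apply: idealB => //; apply: idealM.
  have -> : y = c * z - d * w by rewrite cz; ring.
  have -> : y' = m * z - d * u by rewrite mz; ring.
  by ring.
exists (z - d * t); last by exists t; ring.
apply: nc; rewrite (_ : _ * _ = y + d * y2).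
  by apply: idealD => //; apply: idealM.
by rewrite mulrBr cz def_w; ring.
Qed.

(** The ideals modulo which the entries of a regular sequence are tested,
    together with the one generated by all of them. *)
Fixpoint partial_ideals J s : seq (A -> Prop) :=
  J :: (if s is c :: s' then partial_ideals (adjoin J c) s' else [::]).

Lemma nonzerodiv_extend J s c :
  (forall Q, List.In Q (partial_ideals J s) -> nonzerodiv Q c) ->
  nonzerodiv (extend J s) c.
Proof.
elim: s J => [|d s IHs] J /= nc; first by apply: nc; left.
by apply: IHs => Q inQ; apply: nc; right.
Qed.

(** A regular element may be moved to the front of a regular sequence as soon
    as it is regular at every stage. *)
Lemma regular_adjoin J s c :
  ideal J -> regular J s ->
  (forall Q, List.In Q (partial_ideals J s) -> nonzerodiv Q c) ->
  regular (adjoin J c) s.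
Proof.
elim: s J => [|d s IHs] J //= idJ [nd rs] nc; split; last first.
  rewrite adjoinC; apply: IHs => // [|Q inQ]; first exact: ideal_adjoin.
  by apply: nc; right.
have nc_d : nonzerodiv (adjoin J d) c.
  by apply: nc; right; case: (s) => [|? ?]; left.
move=> y [y' Jy' [w def_dy]].
have [|v Jv [t def_w]] := nc_d w.
  exists (- y'); first exact: idealN.
  by exists y; rewrite def_dy; ring.
exists (y - c * t); last by exists t; ring.
apply: nd; rewrite (_ : _ * _ = y' + c * v).
  by apply: idealD => //; apply: idealM.
by rewrite mulrBr def_dy def_w; ring.
Qed.

Lemma partial_ideals_nonzerodiv M J s x :
  ideal J -> regular J (rcons s x) -> (forall c, c \in rcons s x -> M c) ->
  forall Q, List.In Q (partial_ideals J s) ->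
    ideal Q /\ exists2 c, M c & nonzerodiv Q c.
Proof.
elim: s J => [|c s IHs] J /= idJ [nc rs] sM Q.
  by move=> [<-|//]; split=> //; exists x => //; apply/sM/mem_head.
have idJc := ideal_adjoin c idJ.
case=> [<-|/(IHs _ idJc rs)]; last first.
  by apply=> d sd; apply: sM; rewrite in_cons sd orbT.
by split=> //; exists c => //; apply/sM/mem_head.
Qed.

(** * Zero divisors in Noetherian rings *)

Hypothesis A_noeth : noetherian A.

Lemma noetherian_maximal (F : (A -> Prop) -> Prop) :
  (forall J, F J -> ideal J) -> (exists J, F J) ->
  exists2 J, F J & forall Q, F Q -> sub_ideal J Q -> sub_ideal Q J.
Proof.
move=> F_id [J0 FJ0]; apply: contrapT => no_max.
have step (J : {J | F J}) :
    exists Q : {Q | F Q},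
      sub_ideal (sval J) (sval Q) /\ ~ sub_ideal (sval Q) (sval J).
  case: J => J FJ /=; apply: contrapT => no_next; apply: no_max.
  exists J => // Q FQ JQ; apply: contrapT => nQJ.
  by apply: no_next; exists (exist _ Q FQ).
have {step} [next nextP] := choice step.
pose J n := sval (iter n next (exist _ J0 FJ0)).
have J_id n : ideal (J n) by apply/F_id/svalP.
have J_up n k : sub_ideal (J n) (J (n + k)%N).
  elim: k => [|k IHk] x Jx; rewrite ?addn0 // addnS.
  by have [up _] := nextP (iter (n + k) next (exist _ J0 FJ0)); apply/up/IHk.
have J_mono n k : (n <= k)%N -> sub_ideal (J n) (J k).
  by move=> /subnKC <-; apply: J_up.
have J_strict n : ~ sub_ideal (J n.+1) (J n).
  by have [] := nextP (iter n next (exist _ J0 FJ0)).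
(* [noetherian] speaks of proper ideals only, so the union of the chain has to
   be proper. *)
have J_proper n : ~ J n 1.
  move=> Jn1; apply: (J_strict n) => x _.
  by rewrite -[x]mulr1; apply: idealM.
pose U : {pred A} := fun x => `[< exists n, J n x >].
have [|s Us] := A_noeth (J := U).
  split.
  - by apply/asboolP; exists 0%N; case: (J_id 0%N).
  - by apply/negP => /asboolP[n] /J_proper.
  - move=> a x y /asboolP[n Jx] /asboolP[k Jy]; apply/asboolP.
    exists (maxn n k); case: (J_id (maxn n k)) => _; apply.
      by apply: J_mono Jx; apply: leq_maxl.
    by apply: J_mono Jy; apply: leq_maxr.
have [n Jn] : exists n, forall i : 'I_(size s), J n s`_i.
  have /choice[g gP] (i : 'I_(size s)) : exists n, J n s`_i.
    apply/asboolP; change (s`_i \in U); rewrite Us; apply/asboolP.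
    exists (fun j => (j == i)%:R); rewrite (bigD1 i) //= eqxx mul1r.
    by rewrite big1 ?addr0 // => j /negPf->; rewrite mul0r.
  exists (\max_i g i) => i; apply: J_mono (gP i); exact: leq_bigmax.
apply: (J_strict n) => x Jx.
have : x \in U by apply/asboolP; exists n.+1.
rewrite Us => /asboolP[c ->]; apply: ideal_sum => // i; exact: idealM.
Qed.

(** One element outside [P] from each ideal; their product is the witness. *)
Lemma prime_inter P L :
  prime_set P -> (forall Q, List.In Q L -> ideal Q /\ ~ sub_ideal Q P) ->
  exists2 x, ~ P x & forall Q, List.In Q L -> Q x.
Proof.
move=> [_ P1 P_prime]; elim: L => [|Q L IHL] QL; first by exists 1.
have [|x nPx Lx] := IHL; first by move=> Q' inQ'; apply: QL; right.
have [idQ nQP] := QL Q (or_introl erefl).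
have [y Qy nPy] : exists2 y, Q y & ~ P y.
  apply: contrapT => no_y; apply: nQP => y Qy.
  by apply: contrapT => nPy; apply: no_y; exists y.
exists (x * y) => [/P_prime[]//|Q' [<-|inQ']]; first exact: idealM.
by rewrite mulrC; apply: idealM (Lx _ inQ'); have [] := QL Q' (or_intror inQ').
Qed.

(** Prime avoidance. The primes contained in the first one are dropped, which
    is what makes the correcting term exist. *)
Lemma prime_avoidance M L :
  ideal M -> (forall P, List.In P L -> prime_set P /\ ~ sub_ideal M P) ->
  exists2 c, M c & forall P, List.In P L -> ~ P c.
Proof.
move=> idM; have [n] := ubnP (size L).
elim: n L => // n IHn [|P L] /=; rewrite ?ltnS => leLn PL.
  by exists 0 => //; case: idM.
pose L' := List.filter (fun Q => ~~ `[< sub_ideal Q P >]) L.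
have leL'n : (size L' < n)%N.
  apply: leq_ltn_trans leLn; rewrite /L'; elim: (L) => //= Q L1 IH1.
  by case: ifP => _ /=; [exact: IH1 | exact: leqW].
have inL' Q : List.In Q L' <-> List.In Q L /\ ~ sub_ideal Q P.
  rewrite List.filter_In; split=> [[inQ /negP nQP]|[inQ nQP]]; split=> //.
    by move=> QP; apply: nQP; apply/asboolP.
  by apply/negP => /asboolP.
have [Q /inL'[inQ _]|c Mc L'c] := IHn L' leL'n; first by apply: PL; right.
have [P_prime nMP] := PL P (or_introl erefl).
have avoid d : ~ P d -> (forall Q, List.In Q L' -> ~ Q d) ->
    forall Q, P = Q \/ List.In Q L -> ~ Q d.
  move=> nPd L'd Q [<-|inQ] // Qd.
  have [QP|nQP] := pselect (sub_ideal Q P); first exact/nPd/QP.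
  by apply: (L'd Q) => //; apply/inL'.
have [Pc|nPc] := pselect (P c); last by exists c => //; apply: avoid.
have [|d nPd L'd] := @prime_inter P (M :: L') P_prime.
  move=> Q [<-//|/inL'[inQ nQP]]; split=> //.
  by have [[]] := PL Q (or_intror inQ).
have Md : M d by apply: L'd; left.
exists (c + d); first exact: idealD.
apply: avoid => [Pcd|Q inQ Qcd].
  apply: nPd; rewrite -[d](addrK c) [d + c]addrC.
  by case: P_prime => idP _ _; apply: idealB.
have Qd : Q d by apply: L'd; right.
have [[idQ _ _] _] := PL Q (or_intror ((inL' Q).1 inQ).1).
by apply: (L'c Q inQ); rewrite -[c](addrK d); apply: idealB.
Qed.

(** The maximal annihilators of nonzero elements of [A / J] are prime, and
    every zero divisor lies in one of them. They are finitely many: finitely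
    many of the annihilated elements generate all others, so that every maximal
    annihilator contains a finite intersection of them, and being prime it
    contains, hence equals, one member. *)
Lemma zero_divisors_primes J :
  ideal J ->
  exists L,
    (forall P, List.In P L ->
       prime_set P /\ exists2 z, ~ J z & P = colon J z) /\
    forall c, ~ nonzerodiv J c -> exists2 P, List.In P L & P c.
Proof.
move=> idJ.
pose Z z := ~ J z /\ forall z', ~ J z' ->
  sub_ideal (colon J z) (colon J z') -> sub_ideal (colon J z') (colon J z).
have Z_prime z : Z z -> prime_set (colon J z).
  move=> [nJz zmax]; split; [exact: ideal_colon | by rewrite /colon mul1r |].
  move=> x y Jxyz; have [Jyz|nJyz] := pselect (J (y * z)); first by right.
  left; apply: (zmax (y * z) nJyz) => [t Jtz|].
    by rewrite /colon mulrCA; apply: idealM.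
  by rewrite /colon mulrA.
have Z_zdiv c : ~ nonzerodiv J c -> exists2 z, Z z & colon J z c.
  move=> zc.
  have [y Jcy nJy] : exists2 y, J (c * y) & ~ J y.
    apply: contrapT => no_y; apply: zc => y Jcy.
    by apply: contrapT => nJy; apply: no_y; exists y.
  pose F Q := exists2 z, ~ J z & Q = colon J z /\ Q c.
  have [||_ [z nJz [-> Jcz]] zmax] := @noetherian_maximal F.
  - by move=> _ [z _ [-> _]]; apply: ideal_colon.
  - by exists (colon J y), y.
  exists z => //; split=> // z' nJz' zz'; apply: zmax (zz').
  by exists z' => //; split=> //; apply: zz'.
pose G Q := exists2 l, (forall z, z \in l -> Z z) & Q = extend J l.
have [||_ [l lZ ->] lmax] := @noetherian_maximal G.
- by move=> _ [l _ ->]; apply: ideal_extend.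
- by exists J, [::].
have l_gen z : Z z -> extend J l z.
  move=> Zz; apply: (lmax (extend J (rcons l z))) => [||].
  - exists (rcons l z) => // z'; rewrite mem_rcons in_cons.
    by move=> /predU1P[->|/lZ].
  - by rewrite extend_rcons; apply: sub_adjoin.
  - by rewrite extend_rcons; apply: mem_adjoin; apply: ideal_extend.
have inL P : List.In P (map (colon J) l) -> exists2 z, z \in l & P = colon J z.
  elim: (l) => //= z l' IHl [<-|/IHl[z' l'z' ->]].
    by exists z => //; apply: mem_head.
  by exists z' => //; rewrite in_cons l'z' orbT.
have memL z : z \in l -> List.In (colon J z) (map (colon J) l).
  elim: (l) => //= z' l' IHl; rewrite in_cons => /predU1P[->|/IHl]; first by left.
  by right.
exists (map (colon J) l); split.
  move=> _ /inL[z /lZ Zz ->]; split; first exact: Z_prime.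
  by exists z => //; case: Zz.
move=> c /Z_zdiv[z Zz cz].
have [w lw wz] : exists2 w, w \in l & sub_ideal (colon J w) (colon J z).
  apply: contrapT => no_w.
  have [|x nJxz lx] := @prime_inter _ (map (colon J) l) (Z_prime z Zz).
    move=> _ /inL[w lw ->]; split; first exact: ideal_colon.
    by move=> wz; apply: no_w; exists w.
  apply: nJxz; rewrite /colon mulrC; apply: (_ : colon J x z).
  apply: extend_min (l_gen z Zz) => [|y Jy|w lw]; first exact: ideal_colon.
    by rewrite /colon mulrC; apply: idealM.
  rewrite /colon mulrC; exact: (lx (colon J w) (memL w lw)).
exists (colon J w); first exact: (memL w lw).
have [[nJw wmax] [nJz _]] := (lZ w lw, Zz).
exact: (wmax z).
Qed.

Lemma common_nonzerodiv M L :
  ideal M ->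
  (forall J, List.In J L -> ideal J /\ exists2 c, M c & nonzerodiv J c) ->
  exists2 c, M c & forall J, List.In J L -> nonzerodiv J c.
Proof.
move=> idM ML.
have [L' [L'_prime L'_zdiv]] : exists L',
    (forall P, List.In P L' -> prime_set P /\ ~ sub_ideal M P) /\
    forall J c, List.In J L -> ~ nonzerodiv J c ->
      exists2 P, List.In P L' & P c.
  elim: L ML => [|J L IHL] ML; first by exists [::].
  have [|L1 [L1_prime L1_zdiv]] := IHL.
    by move=> Q inQ; apply: ML; right.
  have [idJ [c Mc nc]] := ML J (or_introl erefl).
  have [L2 [L2_prime L2_zdiv]] := zero_divisors_primes idJ.
  exists (L1 ++ L2)%list; split=> [P|Q d].
    move=> inP; have {inP}[|inP] := List.in_app_or _ _ _ inP.
      exact: L1_prime.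
    have [P_prime [z nJz defP]] := L2_prime P inP.
    by split=> // MP; apply/nJz/nc; have := MP c Mc; rewrite defP.
  case=> [<-|inQ] zd.
    have [P inP Pd] := L2_zdiv d zd.
    by exists P => //; apply: List.in_or_app; right.
  have [P inP Pd] := L1_zdiv Q d inQ zd.
  by exists P => //; apply: List.in_or_app; left.
have [c Mc L'c] := prime_avoidance idM L'_prime.
exists c => // J inJ; apply: contrapT => /(L'_zdiv J c inJ)[P inP].
exact: L'c.
Qed.

(** * Exchange of regular sequences *)

(** An element of [M] that is regular at all stages of both sequences replaces
    their last entries and is then moved to the front, which leaves two shorter
    sequences. *)
Lemma socle_free_exchange M J s t :
  ideal M -> ideal J -> size s = size t ->
  (forall c, c \in s -> M c) -> (forall c, c \in t -> M c) ->
  regular J s -> regular J t ->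
  socle_free M (extend J t) -> socle_free M (extend J s).
Proof.
move=> idM; have [n] := ubnP (size s); elim: n J s t => // n IHn J s t.
case/lastP: s => [|s x]; first by case: t.
case/lastP: t => [|t y]; first by rewrite size_rcons.
rewrite !size_rcons !ltnS => lesn idJ [szst] sM tM rs rt.
have [|c Mc nc] :=
    @common_nonzerodiv M (partial_ideals J s ++ partial_ideals J t)%list idM.
  move=> Q inQ; case: (List.in_app_or _ _ _ inQ).
    exact: partial_ideals_nonzerodiv rs sM _.
  exact: partial_ideals_nonzerodiv rt tM _.
have ncs Q : List.In Q (partial_ideals J s) -> nonzerodiv Q c.
  by move=> inQ; apply: nc; apply: List.in_or_app; left.
have nct Q : List.In Q (partial_ideals J t) -> nonzerodiv Q c.
  by move=> inQ; apply: nc; apply: List.in_or_app; right.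
have [[rs' nx] [rt' ny]] :=
  ((regular_rcons _ _ _).1 rs, (regular_rcons _ _ _).1 rt).
rewrite !extend_rcons => free_t.
have free_t' : socle_free M (adjoin (extend J t) c).
  apply: socle_free_swap free_t => //; first exact: ideal_extend.
    by apply: tM; rewrite mem_rcons mem_head.
  exact: nonzerodiv_extend.
apply: (@socle_free_swap _ _ c) => //; first exact: ideal_extend.
  exact: nonzerodiv_extend.
rewrite -extend_adjoin; apply: (IHn _ s t) => //.
- exact: ideal_adjoin.
- by move=> d sd; apply: sM; rewrite mem_rcons in_cons sd orbT.
- by move=> d td; apply: tM; rewrite mem_rcons in_cons td orbT.
- exact: regular_adjoin.
- exact: regular_adjoin.
- by rewrite extend_adjoin.
Qed.

(** A regular sequence in [M] that can be continued has no socle, and by the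
    exchange every shorter one shares this with an initial part of [t]. *)
Lemma regular_socle_free M J s t :
  ideal M -> ideal J -> (size s < size t)%N ->
  (forall c, c \in s -> M c) -> (forall c, c \in t -> M c) ->
  regular J s -> regular J t -> socle_free M (extend J s).
Proof.
move=> idM idJ lt_st sM tM rs rt.
have /regularP nt := rt.
apply: (@socle_free_exchange _ _ _ (take (size s) t)) => //.
- by rewrite size_takel //; apply: ltnW.
- by move=> c /mem_take /tM.
- apply/regularP => i; rewrite size_takel; last exact: ltnW.
  move=> lt_is.
  rewrite take_takel; last exact: ltnW.
  rewrite nth_take //.
  by apply: nt; apply: ltn_trans lt_st.
- move=> z Mz; apply: (nt (size s) lt_st); apply: Mz.
  by apply/tM/mem_nth.
Qed.

Lemma ideal_genE s x :
  x \in ideal_gen s <-> extend (fun x => x = 0) s x.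
Proof.
split=> [/asboolP[c ->]|].
  have idE := ideal_extend s ideal_zero.
  apply: ideal_sum => // i; apply: idealM => //.
  exact: mem_extend ideal_zero (mem_nth _ (ltn_ord i)).
apply: (extend_min (Q := fun x => x \in ideal_gen s)) => [|_ ->|c sc].
- split=> [|a u v /asboolP[c ->] /asboolP[d ->]]; apply/asboolP.
    by exists (fun=> 0); rewrite big1 // => i _; rewrite mul0r.
  exists (fun i => a * c i + d i); rewrite mulr_sumr -big_split.
  by apply: eq_bigr => i _ /=; ring.
- by apply/asboolP; exists (fun=> 0); rewrite big1 // => i _; rewrite mul0r.
- have lt_cs : (index c s < size s)%N by rewrite index_mem.
  apply/asboolP; exists (fun j => (j == Ordinal lt_cs)%:R).
  rewrite (bigD1 (Ordinal lt_cs)) //= eqxx mul1r nth_index //.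
  by rewrite big1 ?addr0 // => j /negPf->; rewrite mul0r.
Qed.

Lemma regular_seq_regular s : regular_seq s -> regular (fun x => x = 0) s.
Proof.
move=> [_ rs]; apply/regularP => i lt_is y /ideal_genE Jy.
exact/ideal_genE/(rs i y lt_is).
Qed.

End Ideals.

(** * Regular sequences along a surjective ring morphism *)

Section Pullback.
Local Open Scope ring_scope.
Variables (R A : comNzRingType) (f : {rmorphism R -> A}).
Hypothesis f_surj : forall y, exists x, f x = y.

Lemma pullback_adjoin (J : A -> Prop) c :
  (fun p => adjoin J (f c) (f p)) = adjoin (fun p => J (f p)) c.
Proof.
apply/funext => p; apply/propext; split=> [[y Jy [w def_fp]]|[y Jy [w ->]]].
  have [w' def_w] := f_surj w.
  exists (p - c * w'); last by exists w'; rewrite subrK.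
  by rewrite rmorphB rmorphM def_w def_fp addrK.
by exists (f y) => //; exists (f w); rewrite rmorphD rmorphM.
Qed.

Lemma pullback_extend (J : A -> Prop) s :
  (fun p => extend J (map f s) (f p)) = extend (fun p => J (f p)) s.
Proof. by elim: s J => [|c s IHs] J //=; rewrite IHs pullback_adjoin. Qed.

Lemma regular_pullback (J : A -> Prop) s :
  regular J (map f s) <-> regular (fun p => J (f p)) s.
Proof.
elim: s J => [|c s IHs] J //=; rewrite -pullback_adjoin -IHs.
split=> -[nc rs]; split=> // y; first by rewrite rmorphM => /nc.
by have [y' <-] := f_surj y; rewrite -rmorphM => /nc.
Qed.

End Pullback.

Section Independence.
Variables (T : finType) (e : rel T).

Lemma independentP (F : {set T}) :
  reflect (forall u v, u \in F -> v \in F -> e u v = false)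
          (independent e F).
Proof.
apply: (iffP forall_inP) => [indF u v Fu Fv|indF u Fu].
  by have /forall_inP/(_ v Fv)/negPf := indF u Fu.
by apply/forall_inP => v Fv; rewrite indF.
Qed.

End Independence.

(** * The polynomial ring and the edge ideal *)

Section EdgeRingTheory.
Local Open Scope ring_scope.
Variables (K : fieldType) (T : finType) (e : rel T).
Hypotheses (e_sym : symmetric e) (e_irr : irreflexive e).

Notation R := {mpoly K[#|T|]}.
Notation Q := (edge_ring K e).
Notation X := (@vvar K T).
Implicit Types (p : R) (F S C : {set T}) (sigma tau : T -> R).

Definition subst sigma : R -> R :=
  mmap (@mpolyC #|T| K) (fun i => sigma (enum_val i)).

HB.instance Definition _ sigma := GRing.RMorphism.copy (subst sigma)
  (mmap (@mpolyC #|T| K) (fun i => sigma (enum_val i))).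

Lemma substC sigma c : subst sigma c%:MP = c%:MP.
Proof. exact: mmapC. Qed.

Lemma substX sigma v : subst sigma (X v) = sigma v.
Proof. by rewrite /subst mmapX mmap1U enum_rankK. Qed.

Lemma mpoly_ring_ind (P : R -> Prop) :
  (forall c, P c%:MP) -> (forall v, P (X v)) ->
  (forall p q, P p -> P q -> P (p + q)) ->
  (forall p q, P p -> P q -> P (p * q)) -> forall p, P p.
Proof.
move=> PC PX PD PM; elim/mpolyind => [|c m p _ _ Pp]; first exact: PC.
apply: PD => //; rewrite -mul_mpolyC; apply: (PM _ _ (PC c)).
rewrite mpolyXE_id; apply: big_ind => // [|i _]; first exact: (PC 1).
elim: (m i) => [|n IHn]; first exact: (PC 1).
rewrite exprS; apply: PM => //.
by have := PX (enum_val i); rewrite /vvar enum_valK.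
Qed.

Lemma subst_subst sigma tau p :
  subst sigma (subst tau p) = subst (fun v => subst sigma (tau v)) p.
Proof.
elim/mpoly_ring_ind: p => [c|v|p q IHp IHq|p q IHp IHq].
- by rewrite !substC.
- by rewrite !substX.
- by rewrite !rmorphD /= IHp IHq.
- by rewrite !rmorphM /= IHp IHq.
Qed.

(** Used both for reductions modulo an ideal and, with [J] a colon ideal, for
    computing socles. *)
Lemma subst_congr (J : R -> Prop) sigma p :
  ideal J -> (forall v, J (X v - sigma v)) -> J (p - subst sigma p).
Proof.
move=> idJ Jsigma.
elim/mpoly_ring_ind: p => [c|v|p q IHp IHq|p q IHp IHq].
- by rewrite substC subrr; case: idJ.
- by rewrite substX.
- by rewrite rmorphD opprD addrACA; apply: idealD.
- rewrite rmorphM /= (_ : _ - _ =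
    q * (p - subst sigma p) + subst sigma p * (q - subst sigma q)); last by ring.
  by apply: idealD => //; apply: idealM.
Qed.

Lemma X_neq0 v : X v != 0.
Proof.
apply/eqP => /(congr1 (subst (fun=> 1))).
by rewrite substX rmorph0 => /eqP; rewrite oner_eq0.
Qed.

Lemma X_neq1 v : X v - 1 != 0.
Proof.
apply/eqP => /(congr1 (subst (fun=> 0))).
rewrite rmorphB rmorph1 /= substX rmorph0 sub0r => /eqP.
by rewrite oppr_eq0 oner_eq0.
Qed.

Definition in_edge_ideal p : Prop := p \in edge_ideal e.

Lemma ideal_edge_ideal : ideal in_edge_ideal.
Proof.
have [I0 _ I_lin] := ideal_gen_closed (edge_ideal_proper K e).
by split=> // a x y Ix Iy; apply: I_lin.
Qed.

Lemma edge_in_ideal u v : e u v -> in_edge_ideal (X u * X v).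
Proof.
move=> euv; apply/ideal_genE; apply: mem_extend (ideal_zero _) _.
by apply/mapP; exists (u, v); rewrite ?mem_enum ?inE.
Qed.

Lemma edge_ideal_kernel sigma p :
  (forall u v, e u v -> sigma u * sigma v = 0) ->
  in_edge_ideal p -> subst sigma p = 0.
Proof.
move=> sigma_e /ideal_genE.
apply: (@extend_min _ _ (fun q => subst sigma q = 0)) => [|_ ->|q].
- split=> [|a x y x0 y0]; first by rewrite rmorph0.
  by rewrite rmorphD rmorphM /= x0 y0 mulr0 addr0.
- by rewrite rmorph0.
- move=> /mapP[[u v]]; rewrite mem_enum inE /= => euv ->.
  by rewrite rmorphM /= !substX sigma_e.
Qed.

Definition restrict F v : R := if v \in F then X v else 0.

Lemma restrict_kills_edges F u v :
  independent e F -> e u v -> restrict F u * restrict F v = 0.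
Proof.
move=> /independentP indF euv; rewrite /restrict.
case: ifP => [Fu|_]; last by rewrite mul0r.
by case: ifP => [Fv|_]; [rewrite indF in euv | rewrite mulr0].
Qed.

Definition msupport (m : 'X_{1..#|T|}) := [set v | m (enum_rank v) != 0%N].

Lemma restrict_monomial F m :
  subst (restrict F) 'X_[m] = if msupport m \subset F then 'X_[m] else 0.
Proof.
rewrite /subst mmapX /mmap1; case: ifP => [/subsetP mF|/negbT].
  rewrite mpolyXE_id; apply: eq_bigr => i _.
  have [->|nz_mi] := eqVneq (m i) 0%N; first by rewrite !expr0.
  by rewrite /restrict mF /vvar ?inE enum_valK.
case/subsetPn => v; rewrite inE => nz_mv nFv.
rewrite (bigD1 (enum_rank v)) //= enum_rankK /restrict (negPf nFv).
by rewrite expr0n (negPf nz_mv) mul0r.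
Qed.

Lemma coeff_restrict F p m :
  msupport m \subset F -> (subst (restrict F) p)@_m = p@_m.
Proof.
move=> mF; elim/mpolyind: p => [|c m' p _ _ IHp]; first by rewrite rmorph0.
rewrite rmorphD /= !mcoeffD IHp; congr (_ + _).
rewrite -mul_mpolyC rmorphM /= substC restrict_monomial !mcoeffCM.
case: ifP => // m'F; rewrite mcoeff0 mcoeffX.
by case: eqP => // def_m; rewrite def_m mF in m'F.
Qed.

(** The edge ideal is the intersection of the primes of the independent sets.
    A monomial outside it has independent support, hence survives in the
    restriction to that support. *)
Lemma edge_idealP p :
  in_edge_ideal p <->
  forall F, independent e F -> subst (restrict F) p = 0.
Proof.
split=> [Ip F indF|res0].
  by apply: edge_ideal_kernel Ip => u v; apply: restrict_kills_edges.
rewrite [p]mpolyE; apply: ideal_sum ideal_edge_ideal _ => m.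
rewrite -mul_mpolyC; have idI := ideal_edge_ideal.
have [indm|] := boolP (independent e (msupport m)).
  rewrite -(coeff_restrict p (subxx _)) res0 // mcoeff0 mul0r.
  by case: idI.
case/forall_inPn => u mu /forall_inPn[v mv /negPn euv]; apply: idealM => //.
have uv : enum_rank u != enum_rank v.
  by apply: contraTneq euv => /enum_rank_inj->; rewrite e_irr.
have le_m : (U_(enum_rank u) + U_(enum_rank v) <= m)%MM.
  apply/mnm_lepP => i; rewrite mnmDE !mnm1E.
  move: mu mv; rewrite !inE -!lt0n.
  have [<- mu _|_ _ mv] := eqVneq (enum_rank u) i.
    by rewrite eq_sym (negPf uv).
  by case: eqVneq => [<-|].
rewrite -(submK le_m) !mpolyXD; apply: idealM => //.
exact: edge_in_ideal.
Qed.
(** * Primes and points of the edge ring *)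

Definition proj : R -> Q := \pi_({ideal_quot (@edge_ideal K T e)})%qT.

HB.instance Definition _ := GRing.RMorphism.copy proj
  (\pi_({ideal_quot (@edge_ideal K T e)})%qT).

Lemma proj_surj x : exists p, proj p = x.
Proof. by exists (repr (x : {ideal_quot (@edge_ideal K T e)})); apply: reprK. Qed.

Lemma proj_eq0 p : proj p = 0 <-> in_edge_ideal p.
Proof.
rewrite -(rmorph0 proj) /in_edge_ideal -[in X in _ <-> X](subr0 p).
rewrite Quotient.idealrBE; split=> [/eqP|/eqP] //.
Qed.

Definition kills_edges sigma := forall u v, e u v -> sigma u * sigma v = 0.

Definition kernel sigma : {pred Q} :=
  fun x => `[< exists2 p, proj p = x & subst sigma p = 0 >].

Lemma kernelE sigma p :
  kills_edges sigma -> (proj p \in kernel sigma) = (subst sigma p == 0).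
Proof.
move=> sigma_e; apply/asboolP/eqP => [[q pq q0]|p0]; last by exists p.
have /proj_eq0/(edge_ideal_kernel sigma_e) : proj (p - q) = 0.
  by rewrite rmorphB /= pq subrr.
by rewrite rmorphB /= q0 subr0.
Qed.

Lemma kernel_prime sigma : kills_edges sigma -> prime_ideal (kernel sigma).
Proof.
move=> sigma_e; have kE := kernelE _ sigma_e; split; first split.
- by rewrite -(rmorph0 proj) kE rmorph0.
- by rewrite -(rmorph1 proj) kE rmorph1 oner_eq0.
- move=> a x y; have [p <-] := proj_surj a.
  have [q <-] := proj_surj x; have [r <-] := proj_surj y.
  rewrite -rmorphM -rmorphD !kE => /eqP q0 /eqP r0.
  by rewrite rmorphD rmorphM /= q0 r0 mulr0 addr0.
- move=> x y; have [p <-] := proj_surj x; have [q <-] := proj_surj y.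
  by rewrite -rmorphM !kE rmorphM /= mulf_eq0.
Qed.

(** Substituting these values is evaluation at a point, which lies on the variety
    of the edge ideal when [S] is independent. *)
Definition point S v : R := if v \in S then 1 else 0.

Lemma point_kills_edges S : independent e S -> kills_edges (point S).
Proof.
move=> /independentP indS u v euv; rewrite /point.
case: ifP => [Su|_]; last by rewrite mul0r.
by case: ifP => [Sv|_]; [rewrite indS in euv | rewrite mulr0].
Qed.

Lemma subst_point_const S p : exists c, subst (point S) p = c%:MP.
Proof.
elim/mpoly_ring_ind: p => [c|v|p q [c def_p] [d def_q]|p q [c def_p] [d def_q]].
- by exists c; rewrite substC.
- by rewrite substX /point; case: ifP => _; [exists 1 | exists 0].
- by exists (c + d); rewrite rmorphD /= def_p def_q mpolyCD.
- by exists (c * d); rewrite rmorphM /= def_p def_q mpolyCM.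
Qed.

Lemma kernel_point_maximal S :
  independent e S -> maximal_ideal (kernel (point S)).
Proof.
move=> indS; have pS := point_kills_edges indS.
have [M_id _] := kernel_prime pS; split=> // J [J0 J1 J_lin] MJ x Jx.
have [p def_x] := proj_surj x; rewrite -def_x kernelE //.
have [c def_c] := subst_point_const S p; rewrite def_c.
have [-> | nz_c] := eqVneq c 0; first by rewrite mpolyC0.
case/negP: J1.
have Mp : proj (p - c%:MP) \in J.
  by apply: MJ; rewrite kernelE // rmorphB /= substC def_c subrr.
have Jc : proj c%:MP \in J.
  rewrite -[c%:MP](subKr p) rmorphB /= addrC -mulN1r; apply: J_lin => //.
  by rewrite def_x.
have <- : proj (c^-1)%:MP * proj c%:MP + 0 = 1.
  by rewrite addr0 -rmorphM /= -mpolyCM mulVf // mpolyC1 rmorph1.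
exact: J_lin.
Qed.

(** Fixing the coordinates in [F] one after the other, at the values they take
    at the point of [S], joins the minimal prime of [F] to the maximal ideal. *)
Definition partial_point S F i v : R :=
  if v \notin F then 0 else if (index v (enum F) < i)%N then point S v else X v.

Lemma point_chain S F :
  independent e F -> S \subset F ->
  prime_chain (fun i => kernel (partial_point S F i)) #|F| (kernel (point S)).
Proof.
move=> /independentP indF sSF.
have kills i : kills_edges (partial_point S F i).
  move=> u v euv; rewrite /partial_point.
  have [Fu|_] := boolP (u \in F); last by rewrite mul0r.
  have [Fv|_] := boolP (v \in F); last by rewrite mulr0.
  by rewrite indF in euv.
split=> [i _|i lt_iF|]; first exact: kernel_prime.
  split=> [x|sub].
    have [p <-] := proj_surj x; rewrite !kernelE // => /eqP p0.
    rewrite -(_ : subst (partial_point S F i.+1) (subst (partial_point S F i) p)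
                  = subst (partial_point S F i.+1) p).
      by rewrite p0 rmorph0.
    rewrite subst_subst; congr (subst _ p); apply/funext => v.
    rewrite [in LHS]/partial_point.
    have [Fv|nFv] := boolP (v \in F); last first.
      by rewrite rmorph0 /partial_point nFv.
    case: ifP => [lt_vi|_]; last by rewrite substX.
    rewrite /partial_point Fv ltnS (ltnW lt_vi).
    by rewrite /point; case: ifP => _; rewrite ?rmorph1 ?rmorph0.
  have [v0 _] : exists v, v \in F by apply/card_gt0P/(leq_ltn_trans _ lt_iF).
  pose v := nth v0 (enum F) i; have lt_i : (i < size (enum F))%N by rewrite -cardE.
  have Fv : v \in F by rewrite -mem_enum mem_nth.
  have idx_v : index v (enum F) = i by rewrite index_uniq ?enum_uniq.
  have := sub (proj (X v - point S v)).
  rewrite !kernelE // !rmorphB /= !substX /partial_point Fv idx_v ltnS leqnn ltnn.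
  have substp sigma : subst sigma (point S v) = point S v.
    by rewrite /point; case: ifP => _; rewrite ?rmorph1 ?rmorph0.
  rewrite /= !substp subrr eqxx => /(_ isT); apply/negP.
  by rewrite /point; case: ifP => _; rewrite ?subr0 ?X_neq1 ?X_neq0.
move=> x; congr (x \in kernel _); apply/funext => v; rewrite /partial_point.
have [Fv|nFv] := boolP (v \in F); first by rewrite cardE index_mem mem_enum Fv.
by rewrite /point [v \in S](contraNF (subsetP sSF v) nFv).
Qed.

(** * The depth at the point of an independent set *)

(** The reduction modulo [X s - 1] for all [s] in [l]: the neighbours of a
    vertex whose variable becomes a unit vanish. *)
Definition specialize (l : seq T) v : R :=
  if v \in l then 1 else if has (e v) l then 0 else X v.

Lemma extend_specialize S l p :
  independent e S -> {subset l <= S} ->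
  extend in_edge_ideal [seq X s - 1 | s <- l] p <->
  in_edge_ideal (subst (specialize l) p).
Proof.
move=> /independentP indS sub_lS; have idI := ideal_edge_ideal.
have I0 : in_edge_ideal 0 by case: idI.
split=> [|Isp]; last first.
  set J := extend _ _; have idJ : ideal J by apply: ideal_extend.
  rewrite -[p](subrK (subst (specialize l) p)); apply: idealD => //; last first.
    exact: sub_extend.
  have Jl s : s \in l -> J (X s - 1).
    by move=> ls; apply: mem_extend (map_f _ ls).
  apply: subst_congr => // v; rewrite /specialize.
  case: ifP => [/Jl//|_]; case: ifP => [/hasP[s /Jl Js evs]|_]; last first.
    by rewrite subrr; case: idJ.
  rewrite (_ : _ - 0 = X v * X s - X v * (X s - 1)); last by ring.
  by apply: idealB => //; [apply/sub_extend/edge_in_ideal | apply: idealM].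
have idP : ideal (fun q => in_edge_ideal (subst (specialize l) q)).
  split=> [|a x y Ix Iy]; first by rewrite rmorph0.
  rewrite rmorphD rmorphM /=; apply: idealD => //; exact: idealM.
have nbr u v : e u v -> u \in l -> specialize l v = 0.
  move=> euv lu; rewrite /specialize; case: ifP => [lv|_].
    by rewrite indS ?sub_lS in euv.
  by case: hasP => // -[]; exists u; rewrite // e_sym.
apply: (extend_min idP) => [q /ideal_genE|q /mapP[s ls ->]]; last first.
  by rewrite rmorphB rmorph1 /= substX /specialize ls subrr.
apply: (extend_min idP) => [_ ->|c /mapP[[u v] uv ->]]; first by rewrite rmorph0.
have {uv}euv : e u v by rewrite mem_enum inE in uv.
rewrite rmorphM /= !substX.
have [lu|nlu] := boolP (u \in l); first by rewrite (nbr u v) // mulr0.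
have [lv|nlv] := boolP (v \in l).
  by rewrite (nbr v u) ?mul0r // e_sym.
rewrite /specialize (negPf nlu) (negPf nlv).
case: ifP => _; first by rewrite mul0r.
by case: ifP => _; rewrite ?mulr0 //; apply: edge_in_ideal.
Qed.

(** Modulo the earlier [X s - 1], the element [X t - 1] vanishes identically on
    no coordinate subspace of the variety. *)
Lemma regular_units S l :
  independent e S -> {subset l <= S} -> uniq l ->
  regular in_edge_ideal [seq X s - 1 | s <- l].
Proof.
move=> indS; elim/last_ind: l => // l t IHl sub_lS.
rewrite rcons_uniq map_rcons => /andP[nlt uniq_l].
have St : t \in S by apply: sub_lS; rewrite mem_rcons mem_head.
have {}sub_lS : {subset l <= S}.
  by move=> s ls; apply: sub_lS; rewrite mem_rcons in_cons ls orbT.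
apply/regular_rcons; split; first exact: IHl.
move=> q /(extend_specialize _ indS sub_lS) Iq.
apply/(extend_specialize _ indS sub_lS)/edge_idealP => F indF.
have spec_t : specialize l t = X t.
  rewrite /specialize (negPf nlt); case: hasP => // -[s /sub_lS Ss].
  by rewrite (independentP _ _ indS).
have := (edge_idealP _).1 Iq F indF.
rewrite !rmorphM !rmorphB !rmorph1 /= substX spec_t substX => /eqP.
rewrite mulf_eq0 => /orP[|/eqP //]; rewrite /restrict.
by case: ifP => _; rewrite ?(negPf (X_neq1 t)) // sub0r oppr_eq0 oner_eq0.
Qed.

(** When the graph outside [S] and its neighbours is complete bipartite with
    parts [C] and [C'], the edge ring modulo [X s - 1] for [s] in [S] embeds
    into the product of the polynomial rings on [C] and on [C'], by means of
    the substitutions [branch S C] and [branch S C']. *)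
Definition branch S C v : R := if v \in S then 1 else restrict C v.

Lemma branch_specialize S C p :
  independent e (S :|: C) ->
  subst (branch S C) (subst (specialize (enum S)) p) = subst (branch S C) p.
Proof.
move=> /independentP indSC.
rewrite subst_subst; congr (subst _ p); apply/funext => v.
rewrite /specialize mem_enum; case: ifP => [Sv|nSv].
  by rewrite rmorph1 /branch Sv.
case: hasP => [[s]|_]; last by rewrite substX.
rewrite mem_enum => Ss evs; rewrite rmorph0 /branch nSv /restrict.
by case: ifP => // Cv; rewrite indSC ?inE ?Ss ?Cv ?orbT in evs.
Qed.

Lemma branch_kills_edges S C : independent e (S :|: C) -> kills_edges (branch S C).
Proof.
move=> /independentP indSC u v euv; rewrite /branch /restrict.
have out w : w \notin S :|: C ->
    (if w \in S then 1 else if w \in C then X w else 0) = 0 :> R.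
  by rewrite inE negb_or => /andP[/negPf-> /negPf->].
have [SCu|/out->] := boolP (u \in S :|: C); last by rewrite mul0r.
have [SCv|/out->] := boolP (v \in S :|: C); last by rewrite mulr0.
by rewrite indSC in euv.
Qed.

Section CompleteBipartiteLink.
Variables (S C C' : {set T}).
Hypotheses (indSC : independent e (S :|: C)) (indSC' : independent e (S :|: C')).
Hypothesis completeCC' : forall c c', c \in C -> c' \in C' -> e c c'.
Hypothesis link_cover :
  forall v, [|| v \in S, v \in C, v \in C' | has (e v) (enum S)].

Lemma link_idealP p :
  in_edge_ideal (subst (specialize (enum S)) p) <->
  subst (branch S C) p = 0 /\ subst (branch S C') p = 0.
Proof.
split=> [Ip|[pC pC']].
  rewrite -(branch_specialize p indSC) -(branch_specialize p indSC').
  by split; apply: edge_ideal_kernel Ip; apply: branch_kills_edges.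
have side (D D' F : {set T}) :
    (forall v, [|| v \in S, v \in D, v \in D' | has (e v) (enum S)]) ->
    independent e (S :|: D) -> {in D', forall v, v \notin F} ->
    subst (branch S D) p = 0 ->
    subst (restrict F) (subst (specialize (enum S)) p) = 0.
  move=> cover /independentP indSD FD' pD.
  transitivity (subst (restrict F) (subst (branch S D) p)); last first.
    by rewrite pD rmorph0.
  rewrite !subst_subst; congr (subst _ p); apply/funext => v.
  rewrite /specialize /branch mem_enum.
  have := cover v; case: ifP => //= nSv.
  case: hasP => [[s]|_] /=.
    rewrite mem_enum => Ss evs _; rewrite /(restrict D); case: ifP => // Dv.
    by rewrite indSD ?inE ?Ss ?Dv ?orbT in evs.
  rewrite /(restrict D); case: ifP => //= nDv; rewrite orbF => D'v.
  by rewrite substX rmorph0 /restrict (negPf (FD' v D'v)).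
apply/edge_idealP => F /independentP indF.
have [[c' C'c' Fc']|nFC'] := pselect (exists2 c', c' \in C' & c' \in F).
  apply: (side C' C) => // [v|c Cc].
    by case/or4P: (link_cover v) => ->; rewrite ?orbT.
  by apply/negP => Fc; have := completeCC' Cc C'c'; rewrite indF.
apply: (side C C') => // v C'v; apply/negP => Fv.
by apply: nFC'; exists v.
Qed.

Variables u u' : T.
Hypotheses (Cu : u \in C) (C'u' : u' \in C').

Let units := [seq X s - 1 | s <- enum S].

Lemma indS : independent e S.
Proof.
move: indSC => /independentP indE; apply/independentP => v w Sv Sw.
by apply: indE; rewrite inE ?Sv ?Sw.
Qed.

Lemma link_extendP p :
  extend in_edge_ideal units p <->
  subst (branch S C) p = 0 /\ subst (branch S C') p = 0.
Proof.
rewrite -link_idealP; apply: extend_specialize indS _ => s.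
by rewrite mem_enum.
Qed.

Lemma branch_off (D D' : {set T}) d d' : independent e (S :|: D) ->
  (forall c c', c \in D -> c' \in D' -> e c c') ->
  d \in D -> d' \in D' -> branch S D d' = 0.
Proof.
move=> /independentP indSD eDD' Dd D'd'; have edd' := eDD' d d' Dd D'd'.
rewrite /branch /restrict; case: ifP => [Sd'|_].
  by rewrite indSD ?inE ?Dd ?Sd' ?orbT in edd'.
by case: ifP => // Dd'; rewrite indSD ?inE ?Dd ?Dd' ?orbT in edd'.
Qed.

Lemma branch_on (D D' : {set T}) d d' : independent e (S :|: D') ->
  (forall c c', c \in D -> c' \in D' -> e c c') ->
  d \in D -> d' \in D' -> branch S D d = X d.
Proof.
move=> /independentP indSD' eDD' Dd D'd'; have edd' := eDD' d d' Dd D'd'.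
rewrite /branch /restrict Dd; case: ifP => // Sd.
by rewrite indSD' ?inE ?D'd' ?Sd ?orbT in edd'.
Qed.

Let eC'C c c' : c \in C' -> c' \in C -> e c c'.
Proof. by move=> C'c Cc'; rewrite e_sym completeCC'. Qed.

Let branchCu : branch S C u = X u.
Proof. exact: branch_on indSC' completeCC' Cu C'u'. Qed.
Let branchCu' : branch S C u' = 0.
Proof. exact: branch_off indSC completeCC' Cu C'u'. Qed.
Let branchC'u : branch S C' u = 0.
Proof. exact: branch_off indSC' eC'C C'u' Cu. Qed.
Let branchC'u' : branch S C' u' = X u'.
Proof. exact: branch_on indSC eC'C C'u' Cu. Qed.

Lemma regular_link : regular in_edge_ideal (rcons units (X u + X u')).
Proof.
apply/regular_rcons; split.
  by apply: regular_units indS _ (enum_uniq _) => s; rewrite mem_enum.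
move=> q /link_extendP[qC qC']; apply/link_extendP; move: qC qC'.
rewrite !rmorphM !rmorphD /= !substX branchCu branchCu' branchC'u branchC'u'.
rewrite addr0 add0r => /eqP; rewrite mulf_eq0 (negPf (X_neq0 u)) => /eqP qC.
by move=> /eqP; rewrite mulf_eq0 (negPf (X_neq0 u')) => /eqP.
Qed.

(** The idempotent that is 1 on the branch of [C] and 0 on the branch of [C'] is
    not an element of the ring, since the branches meet at the point of [S]; but
    its product with any element of the ideal of this point is one, and its
    product with [X u + X u'] is [X u]. Hence [X u] is killed modulo
    [X u + X u'] by that ideal. *)
Lemma link_socle p :
  subst (point S) p = 0 ->
  extend in_edge_ideal (rcons units (X u + X u')) (p * X u).
Proof.
move=> p0; rewrite extend_rcons; set J := adjoin _ _.
have idI := ideal_edge_ideal.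
have idJ : ideal J by apply/ideal_adjoin/ideal_extend.
have IJ q : in_edge_ideal q -> J q by move=> Iq; apply/sub_adjoin/sub_extend.
have Junit s : s \in S -> J (X s - 1).
  move=> Ss; apply: sub_adjoin; apply: mem_extend => //.
  by apply: map_f; rewrite mem_enum.
rewrite -[p]subr0 -p0; apply: (@subst_congr (colon J (X u))).
  exact: ideal_colon.
move=> v; rewrite /colon /point; case: ifP => [Sv|nSv].
  by rewrite mulrC; apply: idealM => //; apply: Junit.
have := link_cover v; rewrite nSv subr0 /=.
case/or3P => [Cv|C'v|/hasP[s]].
- rewrite (_ : _ * _ = X v * (X u + X u') - X v * X u'); last by ring.
  apply: idealB => //; last by apply/IJ/edge_in_ideal/completeCC'.
  by apply: idealM => //; apply/mem_adjoin/ideal_extend.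
- by apply/IJ/edge_in_ideal/eC'C.
- rewrite mem_enum => Ss evs.
  rewrite (_ : _ * _ = X u * (X v * X s) - (X u * X v) * (X s - 1)); last by ring.
  apply: idealB => //; apply: idealM => //; last exact: Junit.
  exact/IJ/edge_in_ideal.
Qed.

(** Dividing [X u] by [X u + X u'] would produce the missing idempotent, with
    the values 1 and 0 at the common point of the branches. *)
Lemma link_socle_neq0 : ~ extend in_edge_ideal (rcons units (X u + X u')) (X u).
Proof.
rewrite extend_rcons => -[y /link_extendP[yC yC'] [w def_u]].
have w1 : subst (branch S C) w = 1.
  have := congr1 (subst (branch S C)) def_u.
  rewrite rmorphD rmorphM rmorphD /= !substX branchCu branchCu' yC add0r addr0.
  by move=> def_X; apply: (mulfI (X_neq0 u)); rewrite mulr1 -def_X.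
have w0 : subst (branch S C') w = 0.
  have := congr1 (subst (branch S C')) def_u.
  rewrite rmorphD rmorphM rmorphD /= !substX branchC'u branchC'u' yC' !add0r.
  by move=> /esym/eqP; rewrite mulf_eq0 (negPf (X_neq0 u')) => /eqP.
have meet D : subst (point S) (subst (branch S D) w) = subst (point S) w.
  rewrite subst_subst; congr (subst _ w); apply/funext => v.
  rewrite /branch /restrict /point; case: ifP => Sv; first by rewrite rmorph1.
  by case: ifP => _; rewrite ?substX ?rmorph0 ?Sv.
have := meet C; rewrite -(meet C') w1 w0 rmorph1 rmorph0 => /eqP.
by rewrite oner_eq0.
Qed.

(** The regular sequence above bounds the depth at the point of [S] by
    [#|S| + 1], whereas [point_chain] bounds its height below by
    [#|S :|: C|]. *)
Lemma cohen_macaulay_link :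
  cohen_macaulay_graph e K -> (#|S :|: C| <= #|S|.+1)%N.
Proof.
move=> [noeth cm]; pose M := kernel (point S).
have [n [[_ height_le] [[b [rb bM size_b]] _]]] :=
  cm M (kernel_point_maximal indS).
have le_n : (#|S :|: C| <= n)%N.
  by apply: height_le (point_chain indSC (subsetUl _ _)).
rewrite leqNgt; apply/negP => lt_SC.
have pS := point_kills_edges indS.
have idM : ideal (fun x => x \in M).
  by have [[M0 _ M_lin] _] := kernel_prime pS; split=> // *; apply: M_lin.
set a := rcons units (X u + X u').
have proj0 : (fun p => proj p = 0) = in_edge_ideal.
  by apply/funext => p; apply/propext/proj_eq0.
have extend_a q :
    extend (fun x => x = 0) (map proj a) (proj q) = extend in_edge_ideal a q.
  have := pullback_extend proj_surj (fun x => x = 0) a.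
  by rewrite proj0 => /(congr1 (fun f => f q)).
have Su : u \in S = false.
  apply: contraTF (completeCC' Cu C'u') => Su.
  by rewrite (independentP _ _ indSC') ?inE ?Su ?C'u' ?orbT.
have Su' : u' \in S = false.
  apply: contraTF (completeCC' Cu C'u') => Su'.
  by rewrite (independentP _ _ indSC) ?inE ?Su' ?Cu ?orbT.
apply: link_socle_neq0; rewrite -extend_a.
apply: (@regular_socle_free _ noeth (fun x => x \in M) _ _ b).
- exact: idM.
- exact: ideal_zero.
- rewrite size_map size_rcons size_map -cardE size_b.
  exact: leq_trans lt_SC le_n.
- move=> _ /mapP[q aq ->]; rewrite kernelE //; move: aq.
  rewrite mem_rcons in_cons => /predU1P[->|/mapP[s]].
    by rewrite rmorphD /= !substX /point Su Su' addr0.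
  rewrite mem_enum => Ss ->.
  by rewrite rmorphB rmorph1 /= substX /point Ss subrr.
- exact: bM.
- by apply/(regular_pullback proj_surj); rewrite proj0; apply: regular_link.
- exact: regular_seq_regular.
- move=> m; have [p <-] := proj_surj m; rewrite kernelE // => /eqP p0.
  by rewrite -rmorphM extend_a; apply: link_socle.
Qed.

End CompleteBipartiteLink.

End EdgeRingTheory.

(** * Perfect matchings of very well-covered graphs *)

Section Neighbourhood.
Variable T : finType.
Implicit Types (r : rel T) (A B Z : {set T}).

Definition nbhd r A := [set v | [exists u in A, r u v]].

Lemma nbhdP r A v : reflect (exists2 u, u \in A & r u v) (v \in nbhd r A).
Proof. by rewrite inE; apply: exists_inP. Qed.

Lemma mem_nbhd r A u v : u \in A -> r u v -> v \in nbhd r A.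
Proof. by move=> Au ruv; apply/nbhdP; exists u. Qed.

Lemma nbhdU r A B : nbhd r (A :|: B) = nbhd r A :|: nbhd r B.
Proof.
apply/setP => v; rewrite in_setU; apply/nbhdP/orP.
  by case=> u; rewrite inE => /orP[Au|Bu] ruv; [left|right]; apply: mem_nbhd ruv.
by case=> /nbhdP[u uin ruv]; exists u; rewrite // inE uin ?orbT.
Qed.

(** Hall's marriage theorem, by the argument of Halmos and Vaughan. *)
Lemma hall r A :
  (forall Z, Z \subset A -> #|Z| <= #|nbhd r Z|) ->
  exists2 f : T -> T, {in A &, injective f} & {in A, forall u, r u (f u)}.
Proof.
have [n] := ubnP #|A|; elim: n r A => // n IHn r A leAn hallA.
have [->|[a Aa]] := set_0Vmem A.
  by exists id => u; rewrite inE.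
(* A tight set is matched on its own and the rest outside its neighbours; if
   there is none, any one edge may be chosen. *)
have [[Z [sZA nZ0 nZA tight]]|loose] :=
    pselect (exists Z, [/\ Z \subset A, Z != set0, Z != A & #|nbhd r Z| <= #|Z|]).
  have ltZA : #|Z| < #|A| by rewrite proper_card // properEneq nZA.
  have [|Y sYZ|f f_inj rf] := IHn r Z; first by lia.
    by apply: hallA; apply: subset_trans sZA.
  pose r' := [rel u v | r u v && (v \notin nbhd r Z)].
  have cardAZ : #|A :\: Z| + #|Z| = #|A|.
    by rewrite -(cardsID Z A) (setIidPr sZA) addnC.
  have Z_gt0 : 0 < #|Z| by rewrite card_gt0.
  have [|Y sYAZ|g g_inj rg] := IHn r' (A :\: Z); first by lia.
    have [sYA disYZ] := subsetDP sYAZ.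
    have sub : nbhd r (Y :|: Z) :\: nbhd r Z \subset nbhd r' Y.
      apply/subsetP => v /setDP[]; rewrite nbhdU inE => /orP[|->//].
      case/nbhdP => u Yu ruv nZv; apply: (mem_nbhd Yu).
      by rewrite /r' /= ruv.
    have := hallA (Y :|: Z); rewrite subUset sYA sZA => /(_ isT).
    have := cardsID (nbhd r Z) (nbhd r (Y :|: Z)).
    have := subset_leq_card sub.
    have := subset_leq_card (subsetIr (nbhd r (Y :|: Z)) (nbhd r Z)).
    by rewrite cardsU (disjoint_setI0 disYZ) cards0; lia.
  have rg' u : u \in A -> u \notin Z -> r' u (g u).
    by move=> Au nZu; apply: rg; rewrite inE nZu.
  have rfg u v : u \in Z -> v \in A -> v \notin Z -> f u <> g v.
    move=> Zu Av nZv eq_fg; have /andP[_ /negP] := rg' v Av nZv; apply.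
    by rewrite -eq_fg; apply: mem_nbhd (rf u Zu).
  exists (fun u => if u \in Z then f u else g u) => [u v Au Av|u Au].
    case: ifPn => [Zu|nZu]; case: ifPn => [Zv|nZv]; first exact: f_inj.
    - by move/rfg => /(_ Zu Av nZv).
    - by move/esym/rfg => /(_ Zv Au nZu).
    - by apply: g_inj; rewrite inE ?nZu ?nZv.
  case: ifPn => [Zu|nZu]; first exact: rf.
  by have /andP[] := rg' u Au nZu.
have [b rab] : exists b, r a b.
  have /card_gt0P[b /nbhdP[_ /set1P->]] : 0 < #|nbhd r [set a]|; last by exists b.
  by apply: leq_trans (hallA [set a] _); rewrite ?cards1 ?sub1set.
pose r' := [rel u v | r u v && (v != b)].
have cardAa : #|A| = #|A :\ a|.+1 by rewrite (cardsD1 a) Aa.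
have [|Y sYAa|g g_inj rg] := IHn r' (A :\ a); first by lia.
  have [->|nY0] := eqVneq Y set0; first by rewrite cards0.
  have [sYA nYa] : Y \subset A /\ a \notin Y.
    by apply/andP; rewrite -subsetD1.
  have nYA : Y != A by apply: contraNneq nYa => ->.
  have ltY : #|Y| < #|nbhd r Y|.
    by rewrite ltnNge; apply/negP => tight; apply: loose; exists Y.
  have sub : nbhd r Y :\ b \subset nbhd r' Y.
    apply/subsetP => v /setD1P[nvb /nbhdP[u Yu ruv]].
    by apply: (mem_nbhd Yu); rewrite /r' /= ruv.
  have := cardsD1 b (nbhd r Y); have := subset_leq_card sub.
  by case: (b \in _); lia.
have rg' u : u \in A -> u != a -> r' u (g u).
  by move=> Au nua; apply: rg; rewrite !inE nua.
exists (fun u => if u == a then b else g u) => [u v Au Av|u Au].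
  case: eqVneq => [->|nua]; case: eqVneq => [->|nva] //.
  - by move=> def_b; have /andP[_ /eqP[]] := rg' v Av nva.
  - by move=> def_b; have /andP[_ /eqP[]] := rg' u Au nua.
  - by apply: g_inj; rewrite !inE ?nua ?nva.
case: eqVneq => [->|nua] //.
by have /andP[] := rg' u Au nua.
Qed.

End Neighbourhood.

Section VeryWellCovered.
Variables (T : finType) (e : rel T).
Hypotheses (e_sym : symmetric e) (e_irr : irreflexive e).
Implicit Types (u v w : T) (X Y Z W D : {set T}).

Lemma independentS Y Z : Y \subset Z -> independent e Z -> independent e Y.
Proof.
move=> /subsetP sYZ /independentP indZ; apply/independentP => u v Yu Yv.
by apply: indZ; apply: sYZ.
Qed.

Lemma independent_extend D Y :
  independent e Y -> Y \subset D ->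
  exists Z, [/\ Y \subset Z, Z \subset D, independent e Z
              & {in D, forall v, v \notin Z -> v \in nbhd e Z}].
Proof.
move=> indY sYD; pose P Z := independent e Z && (Z \subset D).
have [|Z /maxsetP[/andP[indZ sZD] maxZ] sYZ] := @maxset_exists _ P Y.
  by rewrite /P indY.
exists Z; split=> // v Dv nZv; apply: contraNT nZv => nNv.
have <- : v |: Z = Z; last by rewrite setU11.
apply: maxZ (subsetUr _ _); rewrite /P subUset sub1set Dv sZD !andbT.
have nZe w : w \in Z -> e w v = false.
  by move=> Zw; apply: contraNF nNv; apply: mem_nbhd.
apply/independentP => x y /setU1P[->|Zx] /setU1P[->|Zy] //.
- by rewrite e_sym nZe.
- exact: nZe.
- by move/independentP: indZ; apply.
Qed.

Lemma dominating_maxset Z :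
  independent e Z -> (forall v, v \notin Z -> v \in nbhd e Z) ->
  maxset (independent e) Z.
Proof.
move=> indZ domZ; apply/maxsetP; split=> // Y /independentP indY sZY.
apply/eqP; rewrite eqEsubset sZY andbT; apply/subsetP => v Yv.
apply: contraLR (Yv) => /domZ/nbhdP[u Zu euv].
by rewrite indY // (subsetP sZY) in euv.
Qed.

Lemma independentU Y Z :
  independent e Y -> independent e Z -> [disjoint nbhd e Y & Z] ->
  independent e (Y :|: Z).
Proof.
move=> /independentP indY /independentP indZ disYZ.
have YZ u v : u \in Y -> v \in Z -> e u v = false.
  move=> Yu Zv; apply: contraTF Zv => euv.
  by rewrite (disjointFr disYZ) //; apply: mem_nbhd euv.
apply/independentP => u v /setUP[Yu|Zu] /setUP[Yv|Zv].
- exact: indY.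
- exact: YZ.
- by rewrite e_sym YZ.
- exact: indZ.
Qed.

(** Berge's inequality. In a smallest counterexample [X], replacing the
    neighbours in [X] of a maximal independent subset [W] of [nbhd e X] by [W]
    would strictly decrease the size of a maximal independent set. *)
Lemma well_covered_expansion k X :
  (forall u, degree e u != 0) ->
  (forall S, maxset (independent e) S -> #|S| = k) ->
  independent e X -> #|X| <= #|nbhd e X|.
Proof.
move=> deg_gt0 wc; have [n] := ubnP #|X|; elim: n X => // n IHn X leXn indX.
rewrite leqNgt; apply/negP => ltNX.
have [x Xx] : exists x, x \in X by apply/card_gt0P; lia.
have [w exw] : exists w, e x w.
  by have := deg_gt0 x; rewrite -lt0n => /card_gt0P[w]; rewrite inE; exists w.
have [||W [sw sWN indW domW]] := @independent_extend (nbhd e X) [set w].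
- by apply/independentP => u v /set1P-> /set1P->.
- by rewrite sub1set; apply: mem_nbhd exw.
have Ww : w \in W by rewrite -sub1set.
set X1 := X :\: nbhd e W.
have xNW : x \in nbhd e W by apply: (mem_nbhd Ww); rewrite e_sym.
have cardX : #|X :&: nbhd e W| + #|X1| = #|X| by apply: cardsID.
have indX1 : independent e X1 by apply: independentS indX; apply: subsetDl.
have W_small : #|W| + #|X1| < #|X|.
  have /IHn/(_ indX1) : #|X1| < n.
    have : 0 < #|X :&: nbhd e W| by apply/card_gt0P; exists x; rewrite inE Xx.
    by lia.
  have sub : nbhd e X1 \subset nbhd e X :\: W.
    apply/subsetP => v /nbhdP[u /setDP[Xu nNu] euv].
    rewrite inE (mem_nbhd Xu) // andbT; apply: contra nNu => Wv.
    by apply: (mem_nbhd Wv); rewrite e_sym.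
  have := subset_leq_card sub; have := cardsID W (nbhd e X).
  by rewrite (setIidPr sWN); lia.
have ind0 : independent e set0 by apply/independentP => u v; rewrite inE.
have [//||Y1 [_ sY1 indY1 domY1]] :=
  @independent_extend (~: (X :|: nbhd e X :|: nbhd e W)) set0.
  exact: sub0set.
have [//||Y [sY1Y sY indY domY]] :=
  @independent_extend (~: (X :|: nbhd e X)) Y1.
  by apply: subset_trans sY1 _; rewrite setCS subsetUl.
have nbr v : v \in nbhd e X -> v \notin Y.
  move=> Nv; apply: contraL (Nv) => /(subsetP sY).
  by rewrite !inE negb_or => /andP[].
(* Two maximal independent sets: [X] and [W] together with the unaffected part
   of [X], each completed away from [X] and its neighbours. *)
have cardXY : #|X :|: Y| = k.
  apply/wc/dominating_maxset => [|v].
    apply: independentU => //; apply/pred0P => v /=.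
    by apply/negP => /andP[/nbr/negPf->].
  rewrite in_setU negb_or => /andP[nXv nYv]; rewrite nbhdU in_setU.
  have [//|nNv] := boolP (v \in nbhd e X).
  by apply: domY; rewrite // in_setC in_setU negb_or nXv.
have cardWY : #|W :|: X1 :|: Y1| = k.
  apply/wc/dominating_maxset => [|v].
    apply: independentU => //.
      apply: independentU => //; apply/pred0P => v /=.
      by rewrite in_setD; case: (v \in nbhd e W).
    apply/pred0P => v /=; apply/negP => /andP[N1v /(subsetP sY1)].
    rewrite in_setC !in_setU !negb_or => /andP[/andP[_ /negP nNv] /negP nNWv].
    move: N1v; rewrite nbhdU in_setU => /orP[//|/nbhdP[u /setDP[Xu _] euv]].
    by apply: nNv; apply: mem_nbhd euv.
  rewrite !nbhdU !in_setU !negb_or in_setD => /andP[/andP[nWv nX1v] nY1v].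
 have [//|nNWv] := boolP (v \in nbhd e W).
  have [Nv|nNv] := boolP (v \in nbhd e X); first by rewrite domW in nNWv.
  rewrite orbC domY1 // in_setC !in_setU (negPf nNv) (negPf nNWv) !orbF.
  by move: nX1v; rewrite nNWv.
have disXY : [disjoint X & Y].
  apply/pred0P => v /=; apply/negP => /andP[Xv /(subsetP sY)].
  by rewrite !inE Xv.
have := cardsU X Y; rewrite (disjoint_setI0 disXY) cards0 subn0 cardXY.
have : k <= #|W| + #|X1| + #|Y1|.
  rewrite -cardWY; apply: leq_trans (leq_card_setU _ _) _.
  by rewrite leq_add2r leq_card_setU.
by move: (subset_leq_card sY1Y) W_small; clear; lia.
Qed.

Lemma card_maxset_compl Z :
  very_well_covered e -> maxset (independent e) Z -> #|~: Z| = #|Z|.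
Proof.
case=> _ /even_halfK even_T wc /wc cardZ.
by have := cardsC Z; rewrite cardZ -[in RHS]even_T -addnn => /addnI.
Qed.

(** Hall's condition for a maximal independent set is Berge's inequality; the
    matching is perfect because the complement has the same size. *)
Lemma very_well_covered_matching :
  very_well_covered e ->
  exists2 m : T -> T, involutive m & forall v, e v (m v).
Proof.
move=> vwc; have [deg_gt0 _ wc] := vwc.
have ind0 : independent e set0 by apply/independentP => u v; rewrite inE.
have [F maxF _] := maxset_exists ind0.
have indF := maxsetp maxF.
have [|f f_inj ef] := @hall T e F.
  move=> Z sZF; apply: well_covered_expansion deg_gt0 wc _.
  exact: independentS indF.
have nFf u : u \in F -> f u \notin F.
  by move=> Fu; apply: contraTN (ef u Fu) => Ffu; rewrite (independentP _ _ indF).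
have imF : f @: F = ~: F.
  apply/eqP; rewrite eqEcard card_in_imset // card_maxset_compl // leqnn andbT.
  by apply/subsetP => _ /imsetP[u Fu ->]; rewrite inE nFf.
pose m v := if v \in F then f v else odflt v [pick u in F | f u == v].
have m_in v : v \in F -> m v = f v by rewrite /m => ->.
have m_f u : u \in F -> m (f u) = u.
  move=> Fu; rewrite /m (negPf (nFf u Fu)); case: pickP => [u' /andP[Fu' /eqP]|].
    by apply: f_inj.
  by move/(_ u); rewrite Fu eqxx.
have f_onto v : v \notin F -> exists2 u, u \in F & v = f u.
  by rewrite -in_setC -imF => /imsetP.
exists m => v; have [Fv|/f_onto[u Fu ->]] := boolP (v \in F).
- by rewrite (m_in v) // m_f.
- by rewrite (m_f u) // m_in.
- by rewrite m_in // ef.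
- by rewrite m_f // e_sym ef.
Qed.

End VeryWellCovered.

(** * The implication order *)

Section ImplicationOrder.
Variables (T : finType) (e : rel T) (m : T -> T).
Hypotheses (e_sym : symmetric e) (e_irr : irreflexive e).
Hypotheses (e_vwc : very_well_covered e).
Hypotheses (mK : involutive m) (e_m : forall v, e v (m v)).
Implicit Types (u v w : T).

(** A maximal independent set contains exactly one vertex of each pair
    [v, m v], so that containing [u] forces it to contain [w] when [u] and [m w]
    are adjacent. The leaves are the vertices that imply only themselves. *)
Definition implies u w := e u (m w).

Lemma maxset_meets_pairs Z v :
  maxset (independent e) Z -> v \notin Z -> m v \in Z.
Proof.
move=> maxZ nZv; have /independentP indZ := maxsetp maxZ.
have imZ : m @: Z = ~: Z.
  apply/eqP; rewrite eqEcard (card_imset _ (inv_inj mK)).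
  rewrite (card_maxset_compl e_vwc) // leqnn andbT.
  apply/subsetP => _ /imsetP[u Zu ->]; rewrite inE.
  by apply: contraTN (e_m u) => Zmu; rewrite indZ.
have /imsetP[u Zu ->] : v \in m @: Z by rewrite imZ inE.
by rewrite mK.
Qed.

Lemma implies_refl u : implies u u.
Proof. exact: e_m. Qed.

Lemma implies_compl u : implies (m u) u = false.
Proof. exact: e_irr. Qed.

Lemma implies_contra u w : implies u w = implies (m w) (m u).
Proof. by rewrite /implies mK e_sym. Qed.

(** A maximal independent set through nonadjacent [u] and [m w] would miss both
    [v] and [m v]. *)
Lemma implies_trans v u w : implies u v -> implies v w -> implies u w.
Proof.
rewrite /implies => uv vw; apply: contraTT (isT : true) => nuw.
have ind : independent e [set u; m w].
  apply/independentP => x y /set2P[]-> /set2P[]-> //.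
    exact: negPf.
  by rewrite e_sym (negPf nuw).
have [Z maxZ] := maxset_exists ind; rewrite subUset !sub1set => /andP[Zu Zw].
have /independentP indZ := maxsetp maxZ.
have [Zv|/(maxset_meets_pairs maxZ) Zmv] := boolP (v \in Z).
  by rewrite indZ in vw.
by rewrite indZ in uv.
Qed.

Lemma card_implies u : #|[set w | implies u w]| = degree e u.
Proof.
rewrite /degree -(card_imset _ (inv_inj mK)); apply: eq_card => w.
rewrite !inE; apply/imsetP/idP => [[x]|euw]; first by rewrite inE => ux ->.
by exists (m w); rewrite ?inE /implies ?mK.
Qed.

(** Among the vertices implied by [v], take [u] of least degree: the vertices [C]
    that it implies all imply it in turn. Then [C] and the set [C'] of neighbours
    of [u], which consists of the partners of the vertices of [C], are the parts
    of a complete bipartite graph. That graph is what remains after deleting the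
    other vertices [S] of a maximal independent set containing [C'], with the
    neighbours of [S], so by the Cohen-Macaulay property [C] is a single vertex. *)
Lemma implies_leaf (K : fieldType) v :
  cohen_macaulay_graph e K -> exists2 u, leaf e u & implies v u.
Proof.
move=> cm.
pose u := [arg min_(u < v | implies v u) degree e u].
have [vu u_min] : implies v u /\ forall w, implies v w -> degree e u <= degree e w.
  by rewrite /u; case: arg_minnP => [|u' vu' u'_min]; [exact: implies_refl|].
exists u => //; pose C := [set w | implies u w]; pose C' := [set w | e u w].
have wu w : w \in C -> implies w u.
  rewrite inE => uw.
  have /eqP eqC : [set x | implies w x] == C.
    rewrite eqEcard !card_implies u_min ?(implies_trans vu) // andbT.
    by apply/subsetP => x; rewrite !inE; apply: implies_trans.
  by move/setP/(_ u): eqC; rewrite !inE implies_refl.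
have mC w : w \in C' -> m w \in C by rewrite !inE /implies mK.
have Cu : u \in C by rewrite inE implies_refl.
have C'u : m u \in C' by rewrite inE e_m.
have completeC w w' : w \in C -> w' \in C' -> e w w'.
  move=> /wu Cw /mC; rewrite inE => uw'.
  by have := implies_trans Cw uw'; rewrite /implies mK.
have indC : independent e C.
  apply/independentP => w w' Cw Cw'; apply/negP => eww'.
  have ww' : implies w (m w') by rewrite /implies mK.
  have uw : implies u w by rewrite inE in Cw.
  have uw' : implies u w' by rewrite inE in Cw'.
  have Cmw' : m w' \in C by rewrite inE; apply: implies_trans ww'.
  by have := implies_trans (wu _ Cmw') uw'; rewrite implies_compl.
have indC' : independent e C'.
  apply/independentP => w w' C'w C'w'; apply/negP => eww'.
  have ww' : implies w (m w') by rewrite /implies mK.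
  have umw : implies u (m w) by rewrite /implies mK; rewrite inE in C'w.
  have := implies_trans (implies_trans ww' (wu _ (mC _ C'w'))) umw.
  by rewrite /implies mK e_irr.
have [Z maxZ /subsetP sC'Z] := maxset_exists indC'.
have /independentP indZ := maxsetp maxZ.
pose S := Z :\: C'.
have SC' s : s \in S -> s \in C' = false by rewrite inE => /andP[/negPf].
have indSC : independent e (S :|: C).
  apply: independentU => //.
    exact: independentS (subsetDl _ _) (maxsetp maxZ).
  apply/pred0P => w /=; apply/negP => /andP[/nbhdP[s Ss esw]].
  rewrite inE => uw; suff : s \in C' by rewrite SC'.
  have ums : implies u (m s).
    by apply: implies_trans uw _; rewrite implies_contra mK /implies mK.
  by rewrite inE; rewrite /implies mK in ums.
have indSC' : independent e (S :|: C').
  apply: independentS (maxsetp maxZ); rewrite subUset subsetDl.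
  exact/subsetP.
have cover w : [|| w \in S, w \in C, w \in C' | has (e w) (enum S)].
  have [C'w|nC'w] := boolP (w \in C'); first by rewrite !orbT.
  have [Zw|nZw] := boolP (w \in Z); first by rewrite in_setD nC'w Zw.
  have [C'mw|nC'mw] := boolP (m w \in C').
    by have := mC _ C'mw; rewrite mK => ->; rewrite orbT.
  apply/or4P/Or44/hasP; exists (m w) => //.
  by rewrite mem_enum in_setD nC'mw (maxset_meets_pairs maxZ).
have disSC : [disjoint S & C].
  apply/pred0P => w /=; apply/negP => /andP[Sw Cw].
  have := completeC w (m u) Cw C'u; rewrite indZ //; last exact: sC'Z.
  by case/setDP: Sw.
have := cohen_macaulay_link e_sym e_irr indSC indSC' completeC cover Cu C'u cm.
rewrite cardsU (disjoint_setI0 disSC) cards0 subn0 -addn1 leq_add2l card_implies.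
by rewrite /leaf eqn_leq => ->; have [deg_gt0 _ _] := e_vwc; rewrite lt0n deg_gt0.
Qed.

End ImplicationOrder.

Theorem lemma3p3 (K : fieldType) (T : finType) (e : rel T)
  (e_sym : symmetric e) (e_irr : irreflexive e)
  (e_vwc : very_well_covered e) (e_cm : cohen_macaulay_graph e K)
  (two_leaves : #|[set u | leaf e u]| = 2) :
  bipartite e.
Proof.
have [m mK e_m] := very_well_covered_matching e_sym e_irr e_vwc.
have trans := implies_trans e_sym e_irr e_vwc mK e_m.
have /cards2P[p [q [_ leaves]]] := introT eqP two_leaves.
have below v : implies e m v p \/ implies e m v q.
  have [u leaf_u vu] := implies_leaf e_sym e_irr e_vwc mK e_m v e_cm.
  have : u \in [set p; q] by rewrite -leaves inE.
  by case/set2P => <-; [left|right].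
(* A vertex implied by both [v] and [m v] would be implied by its own partner. *)
have apart v r : implies e m v r -> implies e m (m v) r -> False.
  move=> vr mvr; have := trans _ _ _ (_ : implies e m (m r) (m v)) mvr.
  by rewrite -(implies_contra e_sym mK) vr implies_compl // => /(_ isT).
(* Each vertex thus implies one of [p], [q] and its partner implies the other;
   an edge from [u] to [w] is an implication from [u] to the partner of [w]. *)
exists [set v | implies e m v p] => u w euw; rewrite !inE.
have umw : implies e m u (m w) by rewrite /implies mK.
have [wp|nwp] := boolP (implies e m w p).
  have [/(apart w p wp)//|mwq] := below (m w).
  rewrite eqb_id; apply/negP => up.
  have [mup|muq] := below (m u); first exact: (apart u p).
  exact: (apart u q) (trans _ _ _ umw mwq) muq.
have [//|wq] := below w; first by rewrite (negPf nwp).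
have [mwp|mwq] := below (m w); last by case: (apart w q).
by rewrite (trans _ _ _ umw mwp).
Qed.
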